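(* Let $\mathcal{A}$ be an additive category, $\mathcal{X}\subseteq\mathcal{A}$ a full additive subcategory, and $A,B$ objects of $\mathcal{A}$. Assume that $\mathcal{X}$ is skeletally small and that either an $\mathcal{X}$-resolution $X_B$ of $B$ or an $\mathcal{X}$-coresolution ${_AX}$ of $A$ exists. Then there are isomorphisms $${\rm Ext}_{\mathcal{X}, n}(A, B)\simeq {\rm Tor}^\mathcal{X}_{n-1}(\mathcal{A}(-, B), \mathcal{A}(A, -))$$ for all $n\geq 2$; moreover, ${\rm Ext}_{\mathcal{X}, 1}(A, B)$ is isomorphic to the kernel of the canonical map $${\rm can}\colon \mathcal{A}(-, B)\otimes_\mathcal{X} \mathcal{A}(A, -)\longrightarrow \mathcal{A}(A, B),\quad g\otimes f\mapsto g\circ f.$$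
   Context: Cohomological notation is used for complexes. An $\mathcal{X}$-resolution of $B$ is a complex $X_B\colon \cdots\to X_B^{-2}\to X_B^{-1}\to B\to 0$ in $\mathcal{A}$, with $B$ in degree $0$ and $X_B^{-i}$ in degree $-i$, such that $X_B^{-i}\in\mathcal{X}$ for each $i\geq 1$ and ${\rm Hom}_\mathcal{A}(X,X_B)$ is acyclic for each $X\in\mathcal{X}$. Dually, an $\mathcal{X}$-coresolution of $A$ is a complex ${_AX}\colon 0\to A\to {_AX}^1\to{_AX}^2\to\cdots$, with $A$ in degree $0$, such that ${_AX}^i\in\mathcal{X}$ for each $i\ge 1$ and ${\rm Hom}_\mathcal{A}({_AX},X)$ is acyclic for each $X\in\mathcal{X}$. The lower extension groups are ${\rm Ext}_{\mathcal{X},n}(A,B)=H^{-n}{\rm Hom}_\mathcal{A}(A,X_B)$ if $X_B$ exists, or $H^{-n}{\rm Hom}_\mathcal{A}({_AX},B)$ if ${_AX}$ exists (where ${\rm Hom}_\mathcal{A}({_AX}^i,B)$ sits in degree $-i$, with ${_AX}^0=A$); if both exist the two are isomorphic. A left (resp. right) $\mathcal{X}$-module is an additive covariant (resp. contravariant) functor from $\mathcal{X}$ to abelian groups. $\otimes_\mathcal{X}$ is the usual tensor bifunctor between right and left $\mathcal{X}$-modules and ${\rm Tor}^\mathcal{X}_n$ its derived functors. $\mathcal{A}(-,B)$ and $\mathcal{A}(A,-)$ are viewed, by restriction to $\mathcal{X}$, as a right and a left $\mathcal{X}$-module respectively. Explicitly, $\mathcal{A}(-,B)\otimes_\mathcal{X}\mathcal{A}(A,-)=\big(\bigoplus_{X\in\mathcal{X}}\mathcal{A}(X,B)\otimes_{\mathbb{Z}}\mathcal{A}(A,X)\big)/I$,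 where $I$ is generated by the elements $b\circ x\otimes a-b\otimes x\circ a$ for all $x\colon X\to X'$ in $\mathcal{X}$, $a\colon A\to X$, $b\colon X'\to B$. In the map ${\rm can}$, $g\colon X\to B$ and $f\colon A\to X$ with $X\in\mathcal{X}$. *)

(* Defs.v *)
From HB Require Import structures.
From mathcomp Require Import all_boot all_algebra.
From mathcomp Require Import boolp.
From mathcomp.multinomials Require Import freeg.

Set Implicit Arguments.
Unset Strict Implicit.
Unset Printing Implicit Defensive.

Import GRing.Theory.
Local Open Scope ring_scope.
Local Open Scope quotient_scope.

Definition zmod_iso (U V : zmodType) : Prop :=
  exists f : {additive U -> V}, bijective f.

Lemma morphD_nmod (U V : zmodType) (f : U -> V) :
  {morph f : x y / x + y} -> nmod_morphism f.
Proof. by move=> fD; split=> //; apply: (addIr (f 0)); rewrite -fD !add0r. Qed.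

Definition mk_additive (U V : zmodType) (f : U -> V)
    (fD : {morph f : x y / x + y}) : {additive U -> V} :=
  HB.pack f (GRing.isNmodMorphism.Build U V f (morphD_nmod fD)).

Record subg (V : zmodType) (H : zmodClosed V) :=
  SubG { sgval :> V; sgvalP : sgval \in H }.

HB.instance Definition _ V H := [isSub for @sgval V H].
HB.instance Definition _ V H := [Choice of @subg V H by <:].
HB.instance Definition _ V H := [SubChoice_isSubZmodule of @subg V H by <:].

Section Kernel.
Variables (U V : zmodType) (f : {additive U -> V}).

Definition kerp : {pred U} := fun x => f x == 0.

Fact kerp_zmod_closed : zmod_closed kerp.
Proof.
split; first by rewrite unfold_in raddf0.
by move=> x y /eqP fx /eqP fy; rewrite unfold_in raddfB fx fy subrr.
Qed.

HB.instance Definition _ :=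
  GRing.isZmodClosed.Build U kerp kerp_zmod_closed.

Definition kernel : zmodType := subg (kerp : zmodClosed U).

Lemma kernel_eq0 (x : kernel) : f (sgval x) = 0.
Proof. exact/eqP/(sgvalP x). Qed.

Definition kernel_mk x (fx : f x = 0) : kernel :=
  @SubG U (kerp : zmodClosed U) x (introT eqP fx).

Lemma sgval_kernelD : {morph (fun x : kernel => sgval x) : x y / x + y}.
Proof. exact: (raddfD (val : kernel -> U)). Qed.

Lemma sgval_kernel_inj : injective (fun x : kernel => sgval x).
Proof. exact: val_inj. Qed.

End Kernel.

Section Quotient.
Variables (V : zmodType) (I : zmodClosed V).

Definition quotz : zmodType := Quotient.quot I.

Fact piqD : {morph (\pi_(Quotient.quot I) : V -> quotz) : x y / x + y}.
Proof. exact: raddfD. Qed.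

Definition piq : {additive V -> quotz} := mk_additive piqD.

Lemma piq_surj (x : quotz) : exists y, piq y = x.
Proof. by exists (repr (x : Quotient.quot I)); exact: reprK. Qed.

Lemma piq_eq0 x : (piq x == 0) = (x \in I).
Proof.
rewrite -[x in RHS]subr0 Quotient.idealrBE -[0 in LHS](raddf0 piq).
by [].
Qed.

Section Lift.
Variables (W : zmodType) (f : {additive V -> W}).
Hypothesis f0 : {in I, forall x, f x = 0}.

Let lift (x : quotz) : W := f (repr (x : Quotient.quot I)).

Let liftE x : lift (piq x) = f x.
Proof.
apply/eqP; rewrite -subr_eq0 -raddfB f0 // -piq_eq0 raddfB subr_eq0.
by apply/eqP; exact: reprK.
Qed.

Let liftD : {morph lift : x y / x + y}.
Proof.
move=> x y; case: (piq_surj x) => {}x <-; case: (piq_surj y) => {}y <-.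
by rewrite -raddfD !liftE raddfD.
Qed.

Definition quotz_lift : {additive quotz -> W} := mk_additive liftD.

Lemma quotz_liftE x : quotz_lift (piq x) = f x.
Proof. exact: liftE. Qed.

End Lift.
End Quotient.

Section Span.
Variables (V : zmodType) (S : V -> Prop).

Inductive in_span : V -> Prop :=
| span0 : in_span 0
| span_gen x : S x -> in_span x
| spanB x y : in_span x -> in_span y -> in_span (x - y).

Definition span : {pred V} := fun x => `[< in_span x >].

Fact span_zmod_closed : zmod_closed span.
Proof.
split; first exact/asboolP/span0.
by move=> x y /asboolP hx /asboolP hy; apply/asboolP/spanB.
Qed.

HB.instance Definition _ := GRing.isZmodClosed.Build V span span_zmod_closed.

End Span.

Section Presentation.
Variables (K : choiceType) (R : {freeg K / int} -> Prop).

(** Generators [K], relations [r = 0] for [R r]. *)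
Definition pres : zmodType := quotz (span R).

Definition pgen (k : K) : pres := piq (span R) << k >>.

Lemma pres_rel r : R r -> piq (span R) r = 0.
Proof. by move=> Rr; apply/eqP; rewrite piq_eq0; apply/asboolP/span_gen. Qed.

Lemma freeg_ind (P : {freeg K / int} -> Prop) :
    (forall k, P << k >>) -> P 0 -> (forall x y, P x -> P y -> P (x - y)) ->
  forall x, P x.
Proof.
move=> Pk P0 PB.
have PN x : P x -> P (- x) by rewrite -sub0r; exact: PB.
have PD x y : P x -> P y -> P (x + y).
  by move=> Px Py; rewrite -[y]opprK; apply/PB/PN.
have Pn n x : P x -> P (x *+ n).
  by move=> Px; elim: n => [|n IHn]; rewrite ?mulr0n // mulrS; apply: PD.
move=> x; rewrite -[x]freeg_sumE; elim: (dom x) => [|k s IHs].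
  by rewrite big_nil.
rewrite big_cons; apply: PD IHs.
suff Pz (c : int) : P << c *g k >> by exact: Pz.
have ->: << c *g k >> = << k >> *~ c :> {freeg K / int}.
  by rewrite freeg_mulz intz.
by case: c => n; rewrite ?NegzE ?mulrNz; [|apply: PN]; apply: Pn.
Qed.

Lemma pres_ind (P : pres -> Prop) :
    (forall k, P (pgen k)) -> P 0 -> (forall x y, P x -> P y -> P (x - y)) ->
  forall x, P x.
Proof.
move=> Pk P0 PB x; case: (piq_surj x) => {}x <-.
elim/freeg_ind: x => [//||x y Px Py]; first by rewrite raddf0.
by rewrite raddfB; apply: PB.
Qed.

Lemma pres_ext (W : zmodType) (f g : {additive pres -> W}) :
  (forall k, f (pgen k) = g (pgen k)) -> f =1 g.
Proof.
move=> fg; elim/pres_ind => [//||x y fgx fgy]; first by rewrite !raddf0.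
by rewrite !raddfB fgx fgy.
Qed.

Section Lift.
Variables (W : zmodType) (f : K -> W).

Definition freeg_lift (x : {freeg K / int}) : W :=
  fglift (f : K -> zmodule W) x.

Fact freeg_liftB : {morph freeg_lift : x y / x - y}.
Proof. exact: (lift_is_additive (f : K -> zmodule W)). Qed.

Fact freeg_liftD : {morph freeg_lift : x y / x + y}.
Proof.
have f0 : freeg_lift 0 = 0 by have := freeg_liftB 0 0; rewrite !subrr.
have fN x : freeg_lift (- x) = - freeg_lift x.
  by have := freeg_liftB 0 x; rewrite f0 !sub0r.
by move=> x y; rewrite -{1}[y]opprK freeg_liftB fN opprK.
Qed.

Lemma freeg_liftU k : freeg_lift << k >> = f k.
Proof. by rewrite /freeg_lift liftU scale1r. Qed.

Hypothesis fR : forall r, R r -> freeg_lift r = 0.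

Fact freeg_lift0 : {in span R, forall x, mk_additive freeg_liftD x = 0}.
Proof.
move=> x /asboolP; elim=> [|r /fR //|y z _ fy _ fz]; first by rewrite raddf0.
by rewrite raddfB fy fz subrr.
Qed.

Definition pres_lift : {additive pres -> W} := quotz_lift freeg_lift0.

Lemma pres_liftE k : pres_lift (pgen k) = f k.
Proof. by rewrite /pres_lift /pgen quotz_liftE /= freeg_liftU. Qed.

End Lift.
End Presentation.

Record chain := Chain {
  ch :> nat -> zmodType;
  chd : forall n, {additive ch n.+1 -> ch n};
  chdd : forall n x, chd n (chd n.+1 x) = 0 }.

Section Homology.
Variables (K : chain) (n : nat).

Definition cyclep : {pred K n} :=
  match n return {pred K n} with
  | 0 => predT
  | m.+1 => fun x => chd K m x == 0
  end.

Fact cyclep_zmod_closed : zmod_closed cyclep.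
Proof.
rewrite /cyclep; case: n => [//|m]; split; first by rewrite unfold_in raddf0.
by move=> x y /eqP dx /eqP dy; rewrite unfold_in raddfB dx dy subrr.
Qed.

HB.instance Definition _ :=
  GRing.isZmodClosed.Build (K n) cyclep cyclep_zmod_closed.

Definition cycles : zmodType := subg (cyclep : zmodClosed (K n)).

Definition boundaryp : {pred cycles} :=
  fun x => `[< exists y, chd K n y = sgval x >].

Fact boundaryp_zmod_closed : zmod_closed boundaryp.
Proof.
have valB : {morph (fun x : cycles => sgval x) : x y / x - y}.
  exact: (raddfB (val : cycles -> K n)).
split; first by apply/asboolP; exists 0; rewrite raddf0.
move=> x y /asboolP[x' dx] /asboolP[y' dy]; apply/asboolP; exists (x' - y').
by rewrite raddfB dx dy valB.
Qed.

HB.instance Definition _ :=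
  GRing.isZmodClosed.Build cycles boundaryp boundaryp_zmod_closed.

Definition homology : zmodType := quotz (boundaryp : zmodClosed cycles).

End Homology.

Definition acyclic (K : chain) := forall n (x : homology K n), x = 0.

Record preadditive := Preadditive {
  ob :> Type;
  hom : ob -> ob -> zmodType;
  idc : forall X, hom X X;
  comp : forall X Y Z, hom Y Z -> hom X Y -> hom X Z;
  compA : forall W X Y Z (h : hom Y Z) (g : hom X Y) (f : hom W X),
    comp h (comp g f) = comp (comp h g) f;
  comp1c : forall X Y (f : hom X Y), comp (idc Y) f = f;
  compc1 : forall X Y (f : hom X Y), comp f (idc X) = f;
  compDl : forall X Y Z (g g' : hom Y Z) (f : hom X Y),
    comp (g + g') f = comp g f + comp g' f;
  compDr : forall X Y Z (g : hom Y Z) (f f' : hom X Y),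
    comp g (f + f') = comp g f + comp g f' }.

Arguments hom {_} _ _.
Arguments idc {_} _.
Arguments comp {_ X Y Z} _ _.

Definition isomorphic (C : preadditive) (X Y : C) :=
  exists (f : hom X Y) (g : hom Y X), comp g f = idc X /\ comp f g = idc Y.

Definition is_zero_object (C : preadditive) (Z : C) :=
  forall X : C, (forall f : hom X Z, f = 0) /\ (forall f : hom Z X, f = 0).

Definition is_biproduct (C : preadditive) (X Y W : C) :=
  exists (i : hom X W) (j : hom Y W) (p : hom W X) (q : hom W Y),
    [/\ comp p i = idc X, comp q j = idc Y, comp p j = 0, comp q i = 0
      & comp i p + comp j q = idc W].

Definition is_additive (C : preadditive) :=
  (exists Z : C, is_zero_object Z) /\
  (forall X Y : C, exists W : C, is_biproduct X Y W).

Definition op (C : preadditive) : preadditive :=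
  @Preadditive C (fun X Y => hom Y X) idc (fun X Y Z g f => comp f g)
    (fun W X Y Z h g f => esym (compA f g h))
    (fun X Y f => compc1 f) (fun X Y f => comp1c f)
    (fun X Y Z g g' f => compDr f g g') (fun X Y Z g f f' => compDl f f' g).

Definition full (C : preadditive) (P : C -> Prop) : preadditive :=
  @Preadditive {X : C | P X} (fun X Y => hom (sval X) (sval Y))
    (fun X => idc (sval X)) (fun X Y Z g f => comp g f)
    (fun W X Y Z h g f => compA h g f)
    (fun X Y f => comp1c f) (fun X Y f => compc1 f)
    (fun X Y Z g g' f => compDl g g' f) (fun X Y Z g f f' => compDr g f f').

(** [D] is skeletally small when it has a [skeleton].  The "set" [idx] of
    representatives lives in the same universe as the groups [hom X Y], whereas
    the objects of a [preadditive] may form a larger type (for instance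
    [zmodType]). *)
Record skeleton (D : preadditive) := Skeleton {
  idx : choiceType;
  rep :> idx -> D;
  rep_iso : forall X : D, exists i, isomorphic X (rep i) }.

Arguments rep {D} s i.

Fact op_rep_iso (D : preadditive) (S : skeleton D) (X : op D) :
  exists i, @isomorphic (op D) X (S i).
Proof. by case: (rep_iso S X) => i [f [g [gf fg]]]; exists i, g, f. Qed.

Definition op_skeleton (D : preadditive) (S : skeleton D) : skeleton (op D) :=
  @Skeleton (op D) (idx S) (rep S) (op_rep_iso S).

Section Hom.
Variable C : preadditive.

Definition postcomp (A X Y : C) (g : hom X Y) : {additive hom A X -> hom A Y} :=
  mk_additive (fun f f' => compDr g f f').

Definition precomp (A X Y : C) (f : hom X Y) : {additive hom Y A -> hom X A} :=
  mk_additive (fun g g' => compDl g g' f).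

Lemma comp0c (X Y Z : C) (f : hom X Y) : comp (0 : hom Y Z) f = 0.
Proof. exact: (raddf0 (precomp Z f)). Qed.

Lemma compc0 (X Y Z : C) (g : hom Y Z) : comp g (0 : hom X Y) = 0.
Proof. exact: (raddf0 (postcomp X g)). Qed.

End Hom.

Section Resolution.
Variables (C : preadditive) (P : C -> Prop).

Definition augmented (B : C) (T : nat -> C) (n : nat) : C :=
  if n is i.+1 then T i else B.

(** Complexes [... -> T 1 -> T 0 -> B -> 0], where the object [augmented B T n]
    sits in cohomological degree [-n]. *)
Record complex (B : C) := Complex {
  cterm : nat -> C;
  cdiff : forall n, hom (augmented B cterm n.+1) (augmented B cterm n);
  cdiffK : forall n, comp (cdiff n) (cdiff n.+1) = 0 }.

Fact hom_complexK (A B : C) (K : complex B) n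
    (f : hom A (augmented B (cterm K) n.+2)) :
  postcomp A (cdiff K n) (postcomp A (cdiff K n.+1) f) = 0.
Proof. by rewrite /= compA cdiffK comp0c. Qed.

Definition hom_complex (A B : C) (K : complex B) : chain :=
  @Chain (fun n => hom A (augmented B (cterm K) n))
    (fun n => postcomp A (cdiff K n)) (@hom_complexK A B K).

Record resolution (B : C) := Resolution {
  res_complex :> complex B;
  res_term : forall i, P (cterm res_complex i);
  res_acyclic : forall X, P X -> acyclic (hom_complex X res_complex) }.

End Resolution.

(** A complex [0 -> A -> T 0 -> T 1 -> ...] in [C] is a complex
    [... -> T 1 -> T 0 -> A -> 0] in [op C], and [hom_complex] in [op C] is
    then [Hom (-, X)], with [Hom (T i, X)] in degree [-(i + 1)]. *)
Definition coresolution (C : preadditive) (P : C -> Prop) (A : C) :=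
  @resolution (op C) P A.

Definition lower_ext (C : preadditive) (P : C -> Prop) (A B : C)
    (K : resolution P B + coresolution P A) (n : nat) : zmodType :=
  match K with
  | inl XB => homology (hom_complex A XB) n
  | inr AX => homology (@hom_complex (op C) B A AX) n
  end.

Record lmodule (D : preadditive) := LModule {
  mob :> D -> zmodType;
  mact : forall X Y, hom X Y -> {additive mob X -> mob Y};
  mact1 : forall X m, mact (idc X) m = m;
  mactM : forall X Y Z (g : hom Y Z) (f : hom X Y) m,
    mact (comp g f) m = mact g (mact f m);
  mactD : forall X Y (f g : hom X Y) m, mact (f + g) m = mact f m + mact g m }.

Arguments mact {_} _ {X Y} _.

Definition rmodule (D : preadditive) := lmodule (op D).

Record mhom (D : preadditive) (M N : lmodule D) := MHom {
  mfun :> forall X, {additive M X -> N X};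
  mnat : forall X Y (f : hom X Y) m, mfun Y (mact M f m) = mact N f (mfun X m) }.

Definition msurj (D : preadditive) (M N : lmodule D) (e : mhom M N) :=
  forall X (n : N X), exists m, e X m = n.

Definition projective (D : preadditive) (P : lmodule D) :=
  forall (M N : lmodule D) (e : mhom M N) (g : mhom P N), msurj e ->
    exists h : mhom P M, forall X p, e X (h X p) = g X p.

Record projective_resolution (D : preadditive) (M : lmodule D) := ProjRes {
  pr : nat -> lmodule D;
  pr_diff : forall n, mhom (pr n.+1) (pr n);
  pr_aug : mhom (pr 0) M;
  pr_proj : forall n, projective (pr n);
  pr_surj : msurj pr_aug;
  pr_exact0 : forall X p, pr_aug X p = 0 <-> exists q, pr_diff 0 X q = p;
  pr_exact : forall n X p,
    pr_diff n X p = 0 <-> exists q, pr_diff n.+1 X q = p }.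

Section HomModules.
Variables (C : preadditive) (P : C -> Prop).

(** The left module [C(A, -)] over the full subcategory on [P]. *)
Definition homL (A : C) : lmodule (full P) :=
  @LModule (full P) (fun X => hom A (sval X))
    (fun X Y f => postcomp A (f : hom (sval X) (sval Y)))
    (fun X m => comp1c m)
    (fun X Y Z g f m => esym (@compA C A (sval X) (sval Y) (sval Z) g f m))
    (fun X Y f g m => @compDl C A (sval X) (sval Y) f g m).

(** The right module [C(-, B)] over the full subcategory on [P]. *)
Definition homR (B : C) : rmodule (full P) :=
  @LModule (op (full P)) (fun X => hom (sval X) B)
    (fun X Y f => precomp B (f : hom (sval Y) (sval X)))
    (fun X m => compc1 m)
    (fun X Y Z g f m => @compA C (sval Z) (sval Y) (sval X) B m f g)
    (fun X Y f g m => @compDr C (sval Y) (sval X) B m f g).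

End HomModules.

Section FreeModule.
Variables (D : preadditive) (S : skeleton D) (M : lmodule D).

(** [free_ob] is the direct sum of copies of [hom (S i) -] indexed by the pairs
    of [i] and [m : M (S i)], presented by the symbols [(i, m, f)]. *)
Definition fkey : choiceType := {i : idx S & M (S i)}.

Definition fsym (Y : D) : choiceType := {k : fkey & hom (S (tag k)) Y}.

Definition fsymb (Y : D) (k : fkey) (f : hom (S (tag k)) Y) : fsym Y :=
  existT (fun k : fkey => hom (S (tag k)) Y) k f.

Inductive free_rel (Y : D) : {freeg (fsym Y) / int} -> Prop :=
| free_relD k f g :
    free_rel (<< @fsymb Y k (f + g) >> - << fsymb f >> - << fsymb g >>).

Definition free_ob (Y : D) : zmodType := pres (@free_rel Y).

Definition fgen (Y : D) (k : fkey) (f : hom (S (tag k)) Y) : free_ob Y :=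
  pgen _ (fsymb f).

Lemma fgenD (Y : D) (k : fkey) (f g : hom (S (tag k)) Y) :
  fgen (f + g) = fgen f + fgen g.
Proof.
apply/eqP; rewrite -subr_eq0 opprD addrA -!raddfB.
by apply/eqP/pres_rel.
Qed.

Section Lift.
Variables (Y : D) (W : zmodType) (F : forall k : fkey, hom (S (tag k)) Y -> W).
Hypothesis FD : forall k, {morph @F k : f g / f + g}.

Fact free_lift_subproof r :
  free_rel r -> freeg_lift (fun k : fsym Y => F (tagged k)) r = 0.
Proof.
by case=> k f g; rewrite !freeg_liftB !freeg_liftU /= FD addrAC addrK subrr.
Qed.

Definition free_lift : {additive free_ob Y -> W} :=
  pres_lift free_lift_subproof.

Lemma free_liftE k f : free_lift (@fgen Y k f) = F f.
Proof. exact: pres_liftE. Qed.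

End Lift.

Lemma free_ext (Y : D) (W : zmodType) (F G : {additive free_ob Y -> W}) :
  (forall k f, F (@fgen Y k f) = G (fgen f)) -> F =1 G.
Proof. by move=> FG; apply: pres_ext => -[k f]; exact: FG. Qed.

Definition free_act (X Y : D) (y : hom X Y) : {additive free_ob X -> free_ob Y}.
Proof.
refine (@free_lift X (free_ob Y) (fun k f => fgen (comp y f)) _).
by abstract (by move=> k f g /=; rewrite compDr fgenD).
Defined.

#[local] Arguments free_act : simpl never.

Lemma free_actE (X Y : D) (y : hom X Y) k f :
  free_act y (@fgen X k f) = fgen (comp y f).
Proof. exact: free_liftE. Qed.

Fact free_act1 X m : free_act (idc X) m = m.
Proof.
have := @free_ext X _ (free_act (idc X)) idfun; apply=> k f.
by rewrite free_actE comp1c.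
Qed.

Fact free_actM X Y Z (g : hom Y Z) (f : hom X Y) m :
  free_act (comp g f) m = free_act g (free_act f m).
Proof.
have := @free_ext X _ (free_act (comp g f)) (free_act g \o free_act f).
apply=> k h; change (free_act (comp g f) (fgen h) =
  free_act g (free_act f (fgen h))).
by rewrite !free_actE compA.
Qed.

Fact free_actD X Y (f g : hom X Y) m :
  free_act (f + g) m = free_act f m + free_act g m.
Proof.
elim/pres_ind: m => [[k h]||x y Hx Hy]; last 2 first.
- by rewrite !raddf0 addr0.
- by rewrite !raddfB Hx Hy opprD addrACA.
by rewrite -[pgen _ _]/(@fgen X k h) !free_actE compDl fgenD.
Qed.

Definition free : lmodule D := LModule free_act1 free_actM free_actD.

Fact free_projective : projective free.
Proof.
move=> A B e g es.
pose b (k : fkey) : B (S (tag k)) := g _ (fgen (idc (S (tag k)))).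
have [a ea] : exists a : forall k : fkey, A (S (tag k)), forall k, e _ (a k) = b k.
  by exists (fun k => sval (cid (es _ (b k)))) => k; case: cid.
pose H Y := @free_lift Y (A Y) (fun k f => mact A f (a k))
  (fun k f f' => mactD f f' (a k)).
have HE Y k f : H Y (@fgen Y k f) = mact A f (a k) by exact: free_liftE.
have Hn X Y (f : hom X Y) m : H Y (mact free f m) = mact A f (H X m).
  have := @free_ext X _ (H Y \o mact free f) (mact A f \o H X).
  apply=> k h; change (H Y (free_act f (fgen h)) = mact A f (H X (fgen h))).
  by rewrite free_actE !HE mactM.
exists (MHom Hn) => X.
have := @free_ext X _ (e X \o H X) (g X); apply=> k f.
change (e X (H X (fgen f)) = g X (fgen f)).
rewrite HE mnat ea /b -mnat; congr (g X _).
by apply: etrans (free_actE _ _) _; rewrite compc1.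
Qed.

Definition cover_fun (Y : D) : {additive free Y -> M Y} :=
  @free_lift Y (M Y) (fun k f => mact M f (tagged k))
    (fun k f g => mactD f g (tagged k)).

Fact cover_nat X Y (f : hom X Y) m :
  cover_fun Y (mact free f m) = mact M f (cover_fun X m).
Proof.
have := @free_ext X _ (cover_fun Y \o mact free f) (mact M f \o cover_fun X).
apply=> k h.
change (cover_fun Y (free_act f (fgen h)) = mact M f (cover_fun X (fgen h))).
by rewrite free_actE !free_liftE mactM.
Qed.

Definition cover : mhom free M := MHom cover_nat.

Fact cover_surj : msurj cover.
Proof.
move=> Y n; case: (rep_iso S Y) => i [f [g [gf _]]].
pose k : fkey := existT (fun i => M (S i) : Type) i (mact M f n).
exists (fgen (k := k) g); apply: etrans (free_liftE _ _) _ => /=.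
by rewrite -mactM gf mact1.
Qed.

End FreeModule.

Section KernelModule.
Variables (D : preadditive) (M N : lmodule D) (e : mhom M N).

Fact mker_act_subproof X Y (f : hom X Y) (x : kernel (e X)) :
  e Y (mact M f (sgval x)) = 0.
Proof. by rewrite mnat kernel_eq0 raddf0. Qed.

Definition mker_act_fun X Y (f : hom X Y) (x : kernel (e X)) : kernel (e Y) :=
  kernel_mk (mker_act_subproof f x).

Fact mker_actD X Y (f : hom X Y) : {morph mker_act_fun f : x y / x + y}.
Proof.
move=> x y; apply: sgval_kernel_inj; apply: etrans (esym (sgval_kernelD _ _)).
by rewrite /= -raddfD; congr (mact M f _); exact: sgval_kernelD.
Qed.

Definition mker_act X Y (f : hom X Y) : {additive kernel (e X) -> kernel (e Y)} :=
  mk_additive (mker_actD f).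

Fact mker_act1 X m : mker_act (idc X) m = m.
Proof. by apply: sgval_kernel_inj; rewrite /= mact1. Qed.

Fact mker_actM X Y Z (g : hom Y Z) (f : hom X Y) m :
  mker_act (comp g f) m = mker_act g (mker_act f m).
Proof. by apply: sgval_kernel_inj; rewrite /= mactM. Qed.

Fact mker_actDl X Y (f g : hom X Y) m :
  mker_act (f + g) m = mker_act f m + mker_act g m.
Proof.
apply: sgval_kernel_inj; apply: etrans (esym (sgval_kernelD _ _)).
exact: mactD.
Qed.

Definition mker : lmodule D := LModule mker_act1 mker_actM mker_actDl.

End KernelModule.

Section StandardResolution.
Variables (D : preadditive) (S : skeleton D) (M : lmodule D).

Fixpoint syzygy (n : nat) : lmodule D :=
  if n is m.+1 then mker (cover S (syzygy m)) else M.

Definition std_mod n := free S (syzygy n).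

Definition std_diff_fun n X : {additive std_mod n.+1 X -> std_mod n X} :=
  mk_additive (fun x y => etrans (congr1 (fun z => sgval z)
    (raddfD (cover S (syzygy n.+1) X) x y)) (sgval_kernelD _ _)).

Fact std_diff_nat n X Y (f : hom X Y) m :
  std_diff_fun n Y (mact (std_mod n.+1) f m) =
  mact (std_mod n) f (std_diff_fun n X m).
Proof.
exact (congr1 (fun z : kernel (cover S (syzygy n) Y) => sgval z)
  (@cover_nat D S (syzygy n.+1) X Y f m)).
Qed.

Definition std_diff n : mhom (std_mod n.+1) (std_mod n) :=
  MHom (@std_diff_nat n).

Fact std_exact_aux n X (p : std_mod n X) :
  cover S (syzygy n) X p = 0 <-> exists q, std_diff n X q = p.
Proof.
split=> [p0|[q <-]]; last exact: kernel_eq0.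
have [q qE] := @cover_surj D S (syzygy n.+1) X (kernel_mk p0).
by exists q; exact: (congr1 (fun z => sgval z) qE).
Qed.

Fact std_exact n X (p : std_mod n.+1 X) :
  std_diff n X p = 0 <-> exists q, std_diff n.+1 X q = p.
Proof.
rewrite -std_exact_aux; split=> [p0|/= ->//].
exact: sgval_kernel_inj.
Qed.

Definition std_resolution : projective_resolution M :=
  @ProjRes D M std_mod std_diff (cover S M)
    (fun n => @free_projective D S (syzygy n)) (@cover_surj D S M)
    (@std_exact_aux 0) std_exact.

End StandardResolution.

Section Tensor.
Variables (D : preadditive) (S : skeleton D).

Section Def.
Variables (M : rmodule D) (N : lmodule D).

Definition tsym : choiceType := {i : idx S & (M (S i) * N (S i))%type}.

Definition tsymb i (m : M (S i)) (n : N (S i)) : tsym :=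
  existT (fun i => (M (S i) * N (S i))%type) i (m, n).

(** As the objects of [D] may not form a set, [X] runs over the
    representatives [S i] only.  The two biadditivity relations turn the free
    abelian group on the symbols [(i, m, n)] into the direct sum over [i] of the
    tensor products over [int] of [M (S i)] and [N (S i)]. *)
Inductive tensor_rel : {freeg tsym / int} -> Prop :=
| tensor_relDl i (m m' : M (S i)) (n : N (S i)) :
    tensor_rel (<< tsymb (m + m') n >> - << tsymb m n >> - << tsymb m' n >>)
| tensor_relDr i (m : M (S i)) (n n' : N (S i)) :
    tensor_rel (<< tsymb m (n + n') >> - << tsymb m n >> - << tsymb m n' >>)
| tensor_relA i j (x : @hom D (S i) (S j)) (m : M (S j)) (n : N (S i)) :
    tensor_rel (<< @tsymb i (@mact _ M (S j) (S i) x m) n >>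
                - << @tsymb j m (mact N x n) >>).

Definition tensor : zmodType := pres tensor_rel.

Definition tgen i (m : M (S i)) (n : N (S i)) : tensor := pgen _ (tsymb m n).

Lemma tgenDl i (m m' : M (S i)) (n : N (S i)) :
  tgen (m + m') n = tgen m n + tgen m' n.
Proof.
apply/eqP; rewrite -subr_eq0 opprD addrA -!raddfB.
by apply/eqP/pres_rel/tensor_relDl.
Qed.

Lemma tgenDr i (m : M (S i)) (n n' : N (S i)) :
  tgen m (n + n') = tgen m n + tgen m n'.
Proof.
apply/eqP; rewrite -subr_eq0 opprD addrA -!raddfB.
by apply/eqP/pres_rel/tensor_relDr.
Qed.

Lemma tgenA i j (x : @hom D (S i) (S j)) (m : M (S j)) (n : N (S i)) :
  @tgen i (@mact _ M (S j) (S i) x m) n = @tgen j m (mact N x n).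
Proof.
by apply/eqP; rewrite -subr_eq0 -raddfB; apply/eqP/pres_rel/tensor_relA.
Qed.

Section Lift.
Variables (W : zmodType) (F : forall i, M (S i) -> N (S i) -> W).
Hypothesis FDl : forall i m m' n, @F i (m + m') n = F m n + F m' n.
Hypothesis FDr : forall i m n n', @F i m (n + n') = F m n + F m n'.
Hypothesis FA : forall i j (x : @hom D (S i) (S j)) m n,
  @F i (@mact _ M (S j) (S i) x m) n = @F j m (mact N x n).

Fact tensor_lift_subproof r : tensor_rel r ->
  freeg_lift (fun k : tsym => F (tagged k).1 (tagged k).2) r = 0.
Proof.
case=> [i m m' n|i m n n'|i j x m n]; rewrite !freeg_liftB !freeg_liftU /=.
- by rewrite FDl addrAC addrK subrr.
- by rewrite FDr addrAC addrK subrr.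
- by rewrite FA subrr.
Qed.

Definition tensor_lift : {additive tensor -> W} :=
  pres_lift tensor_lift_subproof.

Lemma tensor_liftE i m n : tensor_lift (@tgen i m n) = F m n.
Proof. exact: pres_liftE. Qed.

End Lift.

Lemma tensor_ext (W : zmodType) (F G : {additive tensor -> W}) :
  (forall i m n, F (@tgen i m n) = G (tgen m n)) -> F =1 G.
Proof. by move=> FG; apply: pres_ext => -[i [m n]]; exact: FG. Qed.

End Def.

Section Map.
Variables (M M' : rmodule D) (f : mhom M M') (N : lmodule D).

Definition tensor_map : {additive tensor M N -> tensor M' N}.
Proof.
refine (@tensor_lift M N _ (fun i m n => @tgen M' N i (f _ m) n) _ _ _).
- by abstract (by move=> i m m' n; rewrite raddfD tgenDl).
- by abstract (by move=> i m n n'; rewrite tgenDr).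
- by abstract (by move=> i j x m n; rewrite mnat tgenA).
Defined.

#[local] Arguments tensor_map : simpl never.

Lemma tensor_mapE i m n :
  tensor_map (@tgen M N i m n) = tgen (i := i) (f _ m) n.
Proof. exact: tensor_liftE. Qed.

End Map.

Section Tor.
Variables (M : rmodule D) (R : projective_resolution M) (N : lmodule D).

Fact tensor_complexK n x :
  tensor_map (pr_diff R n) N (tensor_map (pr_diff R n.+1) N x) = 0.
Proof.
have := @tensor_ext _ N _
  (tensor_map (pr_diff R n) N \o tensor_map (pr_diff R n.+1) N) \0.
apply=> i p m.
change (tensor_map (pr_diff R n) N (tensor_map (pr_diff R n.+1) N (tgen p m)) =
  0).
rewrite !tensor_mapE.
rewrite (_ : pr_diff R n _ _ = 0); last by apply/pr_exact; exists p.
by apply: (addIr (tgen 0 m)); rewrite -tgenDl !add0r.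
Qed.

Definition tensor_complex : chain := Chain tensor_complexK.

End Tor.

Definition Tor (n : nat) (M : rmodule D) (N : lmodule D) : zmodType :=
  homology (tensor_complex (std_resolution (op_skeleton S) M) N) n.

End Tensor.

Section Can.
Variables (C : preadditive) (P : C -> Prop) (S : skeleton (full P)) (A B : C).

Definition can : {additive tensor S (homR P B) (homL P A) -> hom A B}.
Proof.
refine (@tensor_lift _ S (homR P B) (homL P A) (hom A B)
  (fun i (g : hom (sval (S i)) B) (f : hom A (sval (S i))) => comp g f) _ _ _).
- by abstract (by move=> i g g' f; exact: compDl).
- by abstract (by move=> i g f f'; exact: compDr).
- by abstract (by move=> i j x g f; exact/esym/compA).
Defined.

Lemma canE i (g : hom (sval (S i)) B) (f : hom A (sval (S i))) :
  can (@tgen _ S (homR P B) (homL P A) i g f) = comp g f.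
Proof. exact: tensor_liftE. Qed.

End Can.

(* Main.v *)
Require Import Defs.
From mathcomp Require Import all_boot all_algebra.
From HB Require Import structures.
From mathcomp Require Import boolp.
(* [hom], [comp] and [free] are to mean those of the preadditive setting. *)
Import Defs.

(** Write [M = C(-, B)] and [N = C(A, -)], as modules over the full subcategory
    on [P].

    Suppose first that [B] has a resolution with terms [T 0], [T 1], ...  By
    Yoneda the modules [C(-, T n)] are projective, so they form a projective
    resolution of [M].  [Tor] may be computed from it, whatever projective
    resolution was used to define it ([homology_tensor_resolution]), and
    [C(-, T n) (x) N] is [N(T n) = C(A, T n)] ([tensor_yoneda]).  So [Tor] in
    degree [n + 1] is the homology of [C(A, T)] at [T (n + 1)], that is [Ext]
    in degree [n + 2].

    Suppose now that [A] has a coresolution, with terms [T 0], [T 1], ...  Here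
    [N] is resolved, whereas [Tor] resolves [M], say by the free modules
    [F 0], [F 1], ...  The double complex [F j (T i)] compares the two: its
    rows [F (T i)] resolve [M(T i) = C(T i, B)] because [F] resolves [M], and
    its columns [F j (T)] resolve [F j (x) N] because [F j] is free, hence
    flat ([free_exact]).  The homologies of [C(T, B)] and of [F (x) N] then
    agree ([acyclic_assembly]).

    In degree 1 only the right exactness of the tensor product matters: in the
    first case [M] is the cokernel of [C(-, T 1) -> C(-, T 0)], so that
    [M (x) N] is the cokernel of [C(A, T 1) -> C(A, T 0)] ([tensl_eq0]), and
    [can] is the map to [C(A, B)] induced by the augmentation; its kernel is
    the homology of [C(A, T)] at [T 0] ([homology1_kernel]).  The second case
    is dual ([tensr_eq0]). *)

Set Implicit Arguments.
Unset Strict Implicit.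
Unset Printing Implicit Defensive.

Import GRing.Theory.
Local Open Scope ring_scope.

(** * Isomorphisms of homology groups *)

Lemma zmod_iso_trans (U V W : zmodType) :
  zmod_iso U V -> zmod_iso V W -> zmod_iso U W.
Proof.
move=> [f bf] [g bg]; have gfD : {morph g \o f : x y / x + y}.
  by move=> x y /=; rewrite !raddfD.
by exists (mk_additive gfD); exact: bij_comp.
Qed.

(** Connecting maps are found by diagram chases that produce a relation rather
    than a function.  An additive relation, total on both sides, that relates 0
    to 0 only is the graph of an isomorphism. *)
Lemma zmod_iso_rel (U V : zmodType) (R : U -> V -> Prop) :
    (forall u v u' v', R u v -> R u' v' -> R (u - u') (v - v')) ->
    (forall u, exists v, R u v) -> (forall v, exists u, R u v) ->
    (forall u v, R u v -> u = 0 <-> v = 0) ->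
  zmod_iso U V.
Proof.
move=> RB /choice[f fR] /choice[g gR] R0.
have Rfun u v v' : R u v -> R u v' -> v = v'.
  move=> uv uv'; apply/eqP; rewrite -subr_eq0; apply/eqP.
  by apply/(R0 _ _ (RB _ _ _ _ uv uv')); rewrite subrr.
have Rinj u u' v : R u v -> R u' v -> u = u'.
  move=> uv uv'; apply/eqP; rewrite -subr_eq0; apply/eqP.
  by apply/(R0 _ _ (RB _ _ _ _ uv uv')); rewrite subrr.
have fD : {morph f : x y / x + y}.
  move=> x y; apply: Rfun (fR _) _.
  have := RB _ _ _ _ (fR x) (RB _ _ _ _ (RB _ _ _ _ (fR x) (fR x)) (fR y)).
  by rewrite !subrr !sub0r !opprK.
exists (mk_additive fD); exists g => x /=; first exact: Rinj (gR _) (fR _).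
exact: Rfun (fR _) (gR _).
Qed.

Section HomologyClass.
Variables (K : chain) (n : nat).

Definition hclass (x : K n.+1) (dx : chd K n x = 0) : homology K n.+1 :=
  piq (boundaryp (n := n.+1) : zmodClosed (cycles K n.+1))
    (@SubG _ (cyclep (n := n.+1) : zmodClosed (K n.+1)) x (introT eqP dx)).

Lemma hclass_surj (u : homology K n.+1) : exists x dx, u = @hclass x dx.
Proof.
case: (piq_surj u) => -[x dx] <-; exists x, (elimT eqP dx).
by congr (piq _ _); exact: val_inj.
Qed.

Lemma hclass_eq0 x dx : @hclass x dx = 0 <-> exists y, chd K n.+1 y = x.
Proof.
split=> [/eqP|xb]; first by rewrite piq_eq0 => /asboolP.
by apply/eqP; rewrite piq_eq0; apply/asboolP.
Qed.

Lemma hclassB x y dx dy dxy :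
  @hclass x dx - @hclass y dy = @hclass (x - y) dxy.
Proof. by rewrite -raddfB; congr (piq _ _); exact: val_inj. Qed.

End HomologyClass.

(** The relation need not be single-valued on cycles: preserving and reflecting
    boundaries makes it so on classes. *)
Lemma homology_rel (K L : chain) (m n : nat) (R : K m.+1 -> L n.+1 -> Prop) :
    (forall x y x' y', R x y -> R x' y' -> R (x - x') (y - y')) ->
    (forall x, chd K m x = 0 -> exists2 y, chd L n y = 0 & R x y) ->
    (forall y, chd L n y = 0 -> exists2 x, chd K m x = 0 & R x y) ->
    (forall x y, R x y ->
      (exists z, chd K m.+1 z = x) <-> (exists z, chd L n.+1 z = y)) ->
  zmod_iso (homology K m.+1) (homology L n.+1).
Proof.
move=> RB Rl Rr R0.
apply: (@zmod_iso_rel _ _ (fun u v => exists x dx y dy,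
  [/\ u = @hclass K m x dx, v = @hclass L n y dy & R x y])) => [|u|v|].
- move=> _ _ _ _ [x [dx [y [dy [-> -> xy]]]]] [x' [dx' [y' [dy' [-> -> xy']]]]].
  have dxx : chd K m (x - x') = 0 by rewrite raddfB dx dx' subrr.
  have dyy : chd L n (y - y') = 0 by rewrite raddfB dy dy' subrr.
  by exists _, dxx, _, dyy; rewrite !hclassB; split=> //; exact: RB.
- case: (hclass_surj u) => x [dx ->]; case: (Rl x dx) => y dy xy.
  by exists (hclass dy), x, dx, y, dy.
- case: (hclass_surj v) => y [dy ->]; case: (Rr y dy) => x dx xy.
  by exists (hclass dx), x, dx, y, dy.
- by move=> _ _ [x [dx [y [dy [-> -> xy]]]]]; rewrite !hclass_eq0; exact: R0.
Qed.

Lemma homology_iso (K L : chain) (n : nat)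
    (f : forall n, {additive K n -> L n}) :
    (forall n, bijective (f n)) ->
    (forall n x, chd L n (f n.+1 x) = f n (chd K n x)) ->
  zmod_iso (homology K n.+1) (homology L n.+1).
Proof.
move=> fb fd; apply: (@homology_rel _ _ _ _ (fun x y => f n.+1 x = y)).
- by move=> x y x' y' <- <-; rewrite raddfB.
- by move=> x dx; exists (f n.+1 x); rewrite ?fd ?dx ?raddf0.
- move=> y dy; case: (fb n.+1) => g _ gK; exists (g y); last exact: gK.
  by apply: (bij_inj (fb n)); rewrite -fd gK dy raddf0.
- move=> x _ <-; split=> [[z <-]|[z dz]]; first by exists (f n.+2 z); rewrite fd.
  case: (fb n.+2) => g _ gK; exists (g z).
  by apply: (bij_inj (fb n.+1)); rewrite -fd gK.
Qed.

Definition shift (K : chain) : chain :=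
  @Chain (fun n => K n.+1) (fun n => chd K n.+1) (fun n => @chdd K n.+1).

(** Dropping the term of degree 0 affects the homology in degrees 0 and 1
    only. *)
Lemma homology_shift (K : chain) (n : nat) :
  zmod_iso (homology K n.+2) (homology (shift K) n.+1).
Proof.
apply: (@homology_rel K (shift K) n.+1 n (fun x y => x = y)) => //.
- by move=> x y x' y' -> ->.
- by move=> x dx; exists x.
- by move=> x dx; exists x.
- by move=> x _ <-.
Qed.

(** When [t] exhibits [W] as the cokernel of [K 2 -> K 1] and [c] is the map
    [W -> K 0] induced by the differential, the classes of 1-cycles are the
    elements of [W] that [c] kills. *)
Lemma homology1_kernel (K : chain) (W : zmodType) (t : {additive K 1%N -> W})
    (c : {additive W -> K 0%N}) :
    (forall w, exists x, t x = w) ->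
    (forall x, t x = 0 <-> exists y, chd K 1%N y = x) ->
    (forall x, c (t x) = chd K 0%N x) ->
  zmod_iso (homology K 1%N) (kernel c).
Proof.
move=> ts tK ct.
apply: (@zmod_iso_rel _ _ (fun u v =>
  exists x dx, u = @hclass K 0 x dx /\ sgval v = t x)) => [|u|v|].
- move=> _ v _ v' [x [dx [-> vE]]] [x' [dx' [-> vE']]].
  have dxx : chd K 0%N (x - x') = 0 by rewrite raddfB dx dx' subrr.
  exists _, dxx; rewrite hclassB; split=> //.
  by rewrite [RHS]raddfB -vE -vE'; exact: (raddfB (val : kernel c -> W)).
- case: (hclass_surj u) => x [dx ->].
  have tx : c (t x) = 0 by rewrite ct.
  by exists (kernel_mk tx), x, dx.
- case: (ts (sgval v)) => x tx; have dx : chd K 0%N x = 0.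
    by rewrite -ct tx kernel_eq0.
  by exists (hclass dx), x, dx; rewrite tx.
- move=> _ v [x [dx [-> vE]]]; rewrite hclass_eq0 -tK -vE.
  by split=> [v0|->//]; exact: sgval_kernel_inj.
Qed.

Lemma homology_equiv (K L : chain) (n : nat)
    (f : forall n, {additive K n -> L n})
    (g : forall n, {additive L n -> K n}) :
    (forall n x, chd L n (f n.+1 x) = f n (chd K n x)) ->
    (forall n y, chd K n (g n.+1 y) = g n (chd L n y)) ->
    (forall x, chd K n x = 0 -> exists z, chd K n.+1 z = g n.+1 (f n.+1 x) - x) ->
    (forall y, chd L n y = 0 -> exists z, chd L n.+1 z = f n.+1 (g n.+1 y) - y) ->
  zmod_iso (homology K n.+1) (homology L n.+1).
Proof.
move=> fd gd gf fg.
apply: (@homology_rel _ _ _ _ (fun x y => chd K n x = 0 /\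
  exists z, chd L n.+1 z = f n.+1 x - y)).
- move=> x y x' y' [dx [z dz]] [dx' [z' dz']]; split.
    by rewrite raddfB dx dx' subrr.
  exists (z - z'); rewrite raddfB dz dz' (raddfB (f n.+1)) !opprB.
  by rewrite addrACA [RHS]addrACA [- y + _]addrC.
- move=> x dx; exists (f n.+1 x); first by rewrite fd dx raddf0.
  by split=> //; exists 0; rewrite subrr raddf0.
- move=> y dy; exists (g n.+1 y); first by rewrite gd dy raddf0.
  by split; [rewrite gd dy raddf0 | exact: fg].
- move=> x y [dx [z dz]]; split=> [[w dw]|[w dw]].
    by exists (f n.+2 w - z); rewrite raddfB fd dw dz subKr.
  case: (gf x dx) => v dv; exists (g n.+2 (z + w) - v).
  by rewrite raddfB gd raddfD dz dw subrK dv subKr.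
Qed.

(** * Acyclic assembly *)

Definition antecedent (U V : zmodType) (f : U -> V) (y : V) : U :=
  if pselect (exists x, f x = y) is left e then sval (cid e) else 0.

Lemma antecedentK (U V : zmodType) (f : U -> V) (y : V) :
  (exists x, f x = y) -> f (antecedent f y) = y.
Proof. by rewrite /antecedent; case: pselect => // e _; case: cid. Qed.

(** The squares commute, so the total complex needs signs; they only appear in
    [zigzag_lift]. *)
Record double_complex := DoubleComplex {
  dc :> nat -> nat -> zmodType;
  dfst : forall i j, {additive dc i.+1 j -> dc i j};
  dsnd : forall i j, {additive dc i j.+1 -> dc i j};
  dfst_dsnd : forall i j x, dfst i j (dsnd i.+1 j x) = dsnd i j (dfst i j.+1 x) }.

Definition transpose (D : double_complex) : double_complex :=
  @DoubleComplex (fun i j => D j i) (fun i j => dsnd D j i) (fun i j => dfst D j i)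
    (fun i j x => esym (dfst_dsnd x)).

(** [U] consists of the cokernels of the first maps of the rows, and the rows
    are exact elsewhere. *)
Record row_resolution (D : double_complex) (U : chain) := RowResolution {
  rr_aug : forall i, {additive D i 0%N -> U i};
  rr_augd : forall i x, rr_aug i (dfst D i 0%N x) = chd U i (rr_aug i.+1 x);
  rr_surj : forall i u, exists x, rr_aug i x = u;
  rr_exact0 : forall i x, rr_aug i x = 0 <-> exists y, dsnd D i 0%N y = x;
  rr_exact : forall i j x, dsnd D i j x = 0 <-> exists y, dsnd D i j.+1 y = x }.

(** Up to signs, a cycle of degree [n] of the total complex.  Indexing it by all
    pairs [(i, j)], not only those with [i + j = n], avoids transports along this
    equation. *)
Definition zigzag (D : double_complex) (n : nat) (x : forall i j, D i j) :=
  forall i j, (i + j.+1 = n)%N -> dfst D i j (x i.+1 j) = dsnd D i j (x i j.+1).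

Lemma extend_family (T : nat -> zmodType) (n : nat) (t : T n) :
  exists f : forall i, T i, f n = t.
Proof.
exists (fun i => if n =P i is ReflectT e then ecast i (T i) e t else 0).
by case: eqP => // e; rewrite eq_axiomK.
Qed.

Section RowResolution.
Variables (D : double_complex) (U : chain) (r : row_resolution D U).
Hypothesis dfstK : forall i j x, dfst D i j (dfst D i.+1 j x) = 0.

Lemma rr_dsndK i j x : dsnd D i j (dsnd D i j.+1 x) = 0.
Proof. by apply/(rr_exact r); exists x. Qed.

(** The augmentation from the total complex to [U] is injective on homology, with
    control on the image of the bounding chain.  The latter is built along the
    diagonal [i + j = n + 1], starting at [j = 0] from a lift of [u]; each next
    entry exists by exactness of a row. *)
Lemma zigzag_boundary n x (u : U n.+1) :
    zigzag n x -> rr_aug r n (x n 0%N) = chd U n u ->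
  exists y : forall i j, D i j, rr_aug r n.+1 (y n.+1 0%N) = u /\
    forall i j, (i + j = n)%N ->
      x i j = dfst D i j (y i.+1 j) + dsnd D i j (y i j.+1).
Proof.
move=> xz xu; have [w wu] := @extend_family U n.+1 u.
pose fix y j : forall i, D i j :=
  if j is k.+1 then
    fun i => antecedent (dsnd D i k) (x i k - dfst D i k (y k i.+1))
  else fun i => antecedent (rr_aug r i) (w i).
have y0 i : rr_aug r i (y 0%N i) = w i by exact/antecedentK/(rr_surj r).
have yS j i : (exists z, dsnd D i j z = x i j - dfst D i j (y j i.+1)) ->
  dsnd D i j (y j.+1 i) = x i j - dfst D i j (y j i.+1) by exact: antecedentK.
exists (fun i j => y j i); split=> [|i j]; first by rewrite y0.
elim: j i => [|j IHj] i ijn.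
  rewrite yS ?subrKC //; apply/(rr_exact0 r).
  rewrite addn0 in ijn; rewrite {i}ijn.
  by rewrite raddfB rr_augd y0 wu xu subrr.
rewrite yS ?subrKC //; apply/(rr_exact r).
rewrite raddfB -dfst_dsnd -xz //; have := IHj i.+1; rewrite addSnnS => /(_ ijn) ->.
by rewrite raddfD dfstK add0r subrr.
Qed.

(** A lift of a cycle [u] bounds the zero zigzag in the sense of
    [zigzag_boundary], once its signs are changed. *)
Lemma zigzag_lift n (u : U n.+1) : chd U n u = 0 ->
  exists x : forall i j, D i j, rr_aug r n.+1 (x n.+1 0%N) = u /\ zigzag n.+1 x.
Proof.
move=> du.
have [||y [yu yz]] := @zigzag_boundary n (fun _ _ => 0) u; rewrite ?du ?raddf0 //.
  by move=> i j _; rewrite !raddf0.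
(* In [y] the images of neighbouring entries are opposite; a zigzag wants them
   equal. *)
exists (fun i j => if odd j then - y i j else y i j); split=> // i j.
rewrite addnS => -[/yz/eqP]; rewrite eq_sym addr_eq0 => /eqP/=.
by case: odd => /= e; rewrite raddfN e ?opprK.
Qed.

End RowResolution.

(** The homologies of [U] and [V] are both that of the total complex: two classes
    correspond when they are the images of one zigzag. *)
Theorem acyclic_assembly (D : double_complex) (U V : chain)
    (rU : row_resolution D U) (rV : row_resolution (transpose D) V) (n : nat) :
  zmod_iso (homology U n.+1) (homology V n.+1).
Proof.
have hh i j x : dfst D i j (dfst D i.+1 j x) = 0 := rr_dsndK rV x.
have vv i j (x : transpose D i.+2 j) :
  dfst (transpose D) i j (dfst (transpose D) i.+1 j x) = 0 := rr_dsndK rU x.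
pose zt (x : forall i j, D i j) : forall i j, transpose D i j := fun i j => x j i.
have ztP x : zigzag n.+1 x -> zigzag n.+1 (zt x).
  by move=> xz i j ijn; apply/esym/xz; rewrite addnC addSnnS.
apply: (@homology_rel _ _ _ _ (fun u v => exists x : forall i j, D i j,
  [/\ zigzag n.+1 x, rr_aug rU n.+1 (x n.+1 0%N) = u
    & rr_aug rV n.+1 (x 0%N n.+1) = v])).
- move=> _ _ _ _ [x [xz <- <-]] [x' [xz' <- <-]].
  exists (fun i j => x i j - x' i j); split; rewrite ?raddfB //.
  by move=> i j ijn; rewrite !raddfB xz ?xz'.
- move=> u du; have [x [xu xz]] := zigzag_lift rU hh du.
  exists (rr_aug rV n.+1 (x 0%N n.+1)); last by exists x.
  rewrite -rr_augd; apply/(rr_exact0 rV); exists (x 1%N n).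
  exact: xz.
- move=> v dv; have [x [xv xz]] := zigzag_lift rV vv dv.
  have xz' : zigzag n.+1 (fun i j => x j i).
    by move=> i j ijn; apply/esym/xz; rewrite addnC addSnnS.
  exists (rr_aug rU n.+1 (x 0%N n.+1)); last by exists (fun i j => x j i).
  rewrite -rr_augd; apply/(rr_exact0 rU); exists (x 1%N n).
  by apply/esym/xz'; rewrite addn1.
- move=> u v [x [xz xu xv]]; split=> [[w dw]|[w dw]].
    rewrite -dw in xu; have [y [_ yx]] := zigzag_boundary hh xz xu.
    exists (rr_aug rV n.+2 (y 0%N n.+2)).
    rewrite -rr_augd -xv yx // raddfD.
    rewrite [X in X + _](_ : _ = 0) ?add0r //.
    by apply/(rr_exact0 rV); exists (y 1%N n.+1).
  rewrite -dw in xv; have [y [_ yx]] := zigzag_boundary vv (ztP _ xz) xv.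
  exists (rr_aug rU n.+2 (y 0%N n.+2)).
  have := yx 0%N n.+1 erefl; rewrite /zt => {}yx.
  rewrite -rr_augd -xu yx raddfD.
  rewrite [X in X + _](_ : _ = 0) ?add0r //.
  by apply/(rr_exact0 rU); exists (y 1%N n.+1).
Qed.

(** * Comparison of projective resolutions *)

Section ModuleMorphisms.
Variable D : preadditive.

Definition mid (M : lmodule D) : mhom M M :=
  @MHom D M M (fun X => idfun) (fun X Y f m => erefl).

Lemma mcomp_nat (L M N : lmodule D) (g : mhom M N) (f : mhom L M) X Y
    (x : hom X Y) m :
  (g Y \o f Y) (mact L x m) = mact N x ((g X \o f X) m).
Proof. by rewrite /= !mnat. Qed.

Definition mcomp (L M N : lmodule D) (g : mhom M N) (f : mhom L M) : mhom L N :=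
  MHom (mcomp_nat g f).

Lemma msub_nat (M N : lmodule D) (f g : mhom M N) X Y (x : hom X Y) m :
  (f Y \- g Y) (mact M x m) = mact N x ((f X \- g X) m).
Proof. by rewrite /= !mnat raddfB. Qed.

Definition msub (M N : lmodule D) (f g : mhom M N) : mhom M N :=
  MHom (msub_nat f g).

Section Corestriction.
Variables (L M N : lmodule D) (e : mhom M N) (f : mhom L M).
Hypothesis ef : forall X l, e X (f X l) = 0.

Lemma mker_lift_subproof X :
  {morph (fun l => kernel_mk (ef l) : kernel (e X)) : x y / x + y}.
Proof.
move=> x y; apply: sgval_kernel_inj; apply: etrans (esym (sgval_kernelD _ _)).
exact: raddfD.
Qed.

Lemma mker_lift_nat X Y (x : hom X Y) l :
  mk_additive (@mker_lift_subproof Y) (mact L x l) =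
  mact (mker e) x (mk_additive (@mker_lift_subproof X) l).
Proof. by apply: sgval_kernel_inj; exact: mnat. Qed.

Definition mker_lift : mhom L (mker e) :=
  @MHom D L (mker e) (fun X => mk_additive (@mker_lift_subproof X))
    mker_lift_nat.

End Corestriction.

(** A map out of a projective into the kernel of [e] lifts along [d], since [d]
    maps onto that kernel. *)
Lemma projective_lift (P L M N : lmodule D) (d : mhom L M) (e : mhom M N)
    (f : mhom P M) :
    projective P ->
    (forall X m, e X m = 0 <-> exists l, d X l = m) ->
    (forall X p, e X (f X p) = 0) ->
  exists h : mhom P L, forall X p, d X (h X p) = f X p.
Proof.
move=> Pproj de ef.
have ed X l : e X (d X l) = 0 by apply/de; exists l.
have ds : msurj (mker_lift ed).
  move=> X m; have /de[l dl] := kernel_eq0 m.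
  by exists l; exact: sgval_kernel_inj.
have [h dh] := Pproj _ _ _ (mker_lift ef) ds.
by exists h => X p; exact: (congr1 (fun z => sgval z) (dh X p)).
Qed.

End ModuleMorphisms.

(** The invariant [G] is what the next choice depends on; [R] is what has to be
    remembered. *)
Lemma dependent_choice_family (T : nat -> Type) (G : forall n, T n -> Prop)
    (R : forall n, T n -> T n.+1 -> Prop) (x : T 0%N) :
    G 0%N x ->
    (forall n x, G n x -> exists y, G n.+1 y /\ R n x y) ->
  exists f : forall n, T n, f 0%N = x /\ forall n, R n (f n) (f n.+1).
Proof.
move=> Gx GR.
pose next n (y : {y | G n y}) := cid (GR n (sval y) (svalP y)).
pose fix s n : {y | G n y} :=
  if n is m.+1 then exist _ (sval (next m (s m))) (proj1 (svalP (next m (s m))))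
  else exist _ x Gx.
exists (fun n => sval (s n)); split=> // n.
exact: (proj2 (svalP (next n (s n)))).
Qed.

Section Comparison.
Variables (D : preadditive) (M : lmodule D).

(** Treating the augmentation as one more differential lets the inductive
    constructions below start in degree 0. *)
Definition pr_target (R : projective_resolution M) n : lmodule D :=
  if n is m.+1 then pr R m else M.

Definition pr_map (R : projective_resolution M) n :
    mhom (pr R n) (pr_target R n) :=
  match n return mhom (pr R n) (pr_target R n) with
  | 0 => pr_aug R
  | m.+1 => pr_diff R m
  end.

Lemma pr_mapP (R : projective_resolution M) n X p :
  pr_map R n X p = 0 <-> exists q, pr_diff R n X q = p.
Proof. by case: n p => [|n] p; [exact: pr_exact0 | exact: pr_exact]. Qed.

Lemma pr_map_diff (R : projective_resolution M) n X q :
  pr_map R n X (pr_diff R n X q) = 0.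
Proof. by apply/pr_mapP; exists q. Qed.

Lemma chain_map_exists (R R' : projective_resolution M) :
  exists f : forall n, mhom (pr R n) (pr R' n),
    (forall X p, pr_aug R' X (f 0%N X p) = pr_aug R X p) /\
    (forall n X p, pr_diff R' n X (f n.+1 X p) = f n X (pr_diff R n X p)).
Proof.
have [f0 f0E] := pr_proj (n := 0%N) (pr_aug R) (@pr_surj _ _ R').
have [X p|n f fK|f [f0' fd]] := @dependent_choice_family
  (fun n => mhom (pr R n) (pr R' n))
  (fun n f => forall X p, pr_map R n X p = 0 -> pr_map R' n X (f X p) = 0)
  (fun n f g => forall X p, pr_diff R' n X (g X p) = f X (pr_diff R n X p)) f0.
- by rewrite /= f0E.
- have [||g gE] := @projective_lift _ (pr R n.+1) _ _ _ (pr_diff R' n)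
    (pr_map R' n) (mcomp f (pr_diff R n)) (@pr_proj _ _ R n.+1).
  + by move=> X m; exact: pr_mapP.
  + by move=> X p; apply: fK; exact: pr_map_diff.
  by exists g; split=> // X p /= dp; rewrite gE /= dp raddf0.
- by exists f; split=> // X p; rewrite f0' f0E.
Qed.

(** At each stage [f n.+1 - h n \o d] takes values in cycles, hence lifts to
    [h n.+1]. *)
Lemma null_homotopy (R R' : projective_resolution M)
    (f : forall n, mhom (pr R n) (pr R' n)) :
    (forall X p, pr_aug R' X (f 0%N X p) = 0) ->
    (forall n X p, pr_diff R' n X (f n.+1 X p) = f n X (pr_diff R n X p)) ->
  exists h : forall n, mhom (pr R n) (pr R' n.+1), forall n X p,
    f n.+1 X p = pr_diff R' n.+1 X (h n.+1 X p) + h n X (pr_diff R n X p).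
Proof.
move=> f0 fd.
have [||h0 h0E] := @projective_lift _ (pr R 0) _ _ _ (pr_diff R' 0)
    (pr_aug R') (f 0%N) (@pr_proj _ _ R 0) => //.
  by move=> X m; exact: pr_exact0.
have [//|n h hf|h [_ hd]] := @dependent_choice_family
  (fun n => mhom (pr R n) (pr R' n.+1))
  (fun n h => forall X p, pr_map R n X p = 0 -> pr_diff R' n X (h X p) = f n X p)
  (fun n h h' => forall X p, f n.+1 X p =
    pr_diff R' n.+1 X (h' X p) + h X (pr_diff R n X p)) h0.
- have [||g gE] := @projective_lift _ (pr R n.+1) _ _ _ (pr_diff R' n.+1)
    (pr_diff R' n) (msub (f n.+1) (mcomp h (pr_diff R n))) (@pr_proj _ _ R n.+1).
  + by move=> X m; exact: pr_exact.
  + by move=> X p /=; rewrite raddfB fd hf ?subrr //; exact: pr_map_diff.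
  exists g; split=> X p; last by rewrite gE /= subrK.
  by move=> /= dp; rewrite gE /= dp raddf0 subr0.
- by exists h => n X p; exact: hd.
Qed.

End Comparison.

Section TensorResolution.
Variables (D : preadditive) (S : skeleton D) (N : lmodule D).

Lemma tensor_ind (M : rmodule D) (Q : tensor S M N -> Prop) :
    (forall i m n, Q (@tgen _ S M N i m n)) -> Q 0 ->
    (forall x y, Q x -> Q y -> Q (x - y)) ->
  forall x, Q x.
Proof. by move=> Qt Q0 QB; apply: pres_ind => // -[i [m n]]; exact: Qt. Qed.

Lemma tensor_map_chain (L M M' P : rmodule D) (f : mhom M P) (e : mhom L M)
    (g : mhom M' P) (d : mhom L M') :
    (forall X p, f X (e X p) = g X (d X p)) ->
  forall x, tensor_map S f N (tensor_map S e N x) =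
            tensor_map S g N (tensor_map S d N x).
Proof.
move=> fe; apply: tensor_ind => [i m n||x y IHx IHy].
- by rewrite !tensor_mapE fe.
- by rewrite !raddf0.
- by rewrite !raddfB IHx IHy.
Qed.

Lemma tensor_map_homotopy (M M' M0 M2 : rmodule D) (f : mhom M M')
    (g : mhom M' M) (d : mhom M2 M) (h : mhom M M2) (d0 : mhom M M0)
    (h0 : mhom M0 M) :
    (forall X p, g X (f X p) = p + d X (h X p) + h0 X (d0 X p)) ->
  forall x, tensor_map S g N (tensor_map S f N x) =
    x + tensor_map S d N (tensor_map S h N x) +
    tensor_map S h0 N (tensor_map S d0 N x).
Proof.
move=> gf; apply: tensor_ind => [i m n||x y IHx IHy].
- by rewrite !tensor_mapE gf !tgenDl.
- by rewrite !raddf0 !addr0.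
- by rewrite !raddfB IHx IHy !opprD addrACA; congr (_ + _); exact: addrACA.
Qed.

(** Comparison maps between two projective resolutions are inverse to each other
    up to homotopy, and homotopies survive tensoring with [N]. *)
Lemma homology_tensor_resolution (M : rmodule D)
    (R R' : projective_resolution M) (n : nat) :
  zmod_iso (homology (tensor_complex S R N) n.+1)
           (homology (tensor_complex S R' N) n.+1).
Proof.
have [f [f0 fd]] := chain_map_exists R R'.
have [g [g0 gd]] := chain_map_exists R' R.
apply: (@homology_equiv (tensor_complex S R N) (tensor_complex S R' N) n
  (fun n => tensor_map S (f n) N) (fun n => tensor_map S (g n) N)).
- by move=> k; apply: tensor_map_chain => X p; exact: fd.
- by move=> k; apply: tensor_map_chain => X p; exact: gd.
- move=> x dx.
  have [||h hE] := @null_homotopy _ _ R R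
    (fun n => msub (mcomp (g n) (f n)) (mid (pr R n))).
  + by move=> X p; rewrite /= raddfB g0 f0 subrr.
  + by move=> k X p; rewrite /= raddfB gd fd.
  have gfE X p : g n.+1 X (f n.+1 X p) =
      p + pr_diff R n.+1 X (h n.+1 X p) + h n X (pr_diff R n X p).
    by apply/eqP; rewrite -addrA addrC -subr_eq -hE.
  exists (tensor_map S (h n.+1) N x).
  rewrite (tensor_map_homotopy gfE) [X in tensor_map S (h n) N X]dx.
  by rewrite raddf0 addr0 addrC addKr.
- move=> x dx.
  have [||h hE] := @null_homotopy _ _ R' R'
    (fun n => msub (mcomp (f n) (g n)) (mid (pr R' n))).
  + by move=> X p; rewrite /= raddfB f0 g0 subrr.
  + by move=> k X p; rewrite /= raddfB fd gd.
  have gfE X p : f n.+1 X (g n.+1 X p) =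
      p + pr_diff R' n.+1 X (h n.+1 X p) + h n X (pr_diff R' n X p).
    by apply/eqP; rewrite -addrA addrC -subr_eq -hE.
  exists (tensor_map S (h n.+1) N x).
  rewrite (tensor_map_homotopy gfE) [X in tensor_map S (h n) N X]dx.
  by rewrite raddf0 addr0 addrC addKr.
Qed.

End TensorResolution.

(** * Tensor products with finitely presented modules *)

Section Image.
Variables (U V : zmodType) (f : {additive U -> V}).

Definition imagep : {pred V} := fun y => `[< exists x, f x = y >].

Fact imagep_zmod_closed : zmod_closed imagep.
Proof.
split; first by apply/asboolP; exists 0; rewrite raddf0.
move=> _ _ /asboolP[x <-] /asboolP[y <-]; apply/asboolP; exists (x - y).
exact: raddfB.
Qed.

HB.instance Definition _ :=
  GRing.isZmodClosed.Build V imagep imagep_zmod_closed.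

Definition coker_proj : {additive V -> quotz (imagep : zmodClosed V)} :=
  piq (imagep : zmodClosed V).

Lemma coker_proj_eq0 y : coker_proj y = 0 <-> exists x, f x = y.
Proof.
split=> [/eqP|yf]; first by rewrite piq_eq0 => /asboolP.
by apply/eqP; rewrite piq_eq0; apply/asboolP.
Qed.

End Image.

(** A right [D]-module is a left module over [op D]; [ract] states its action with
    morphisms of [D]. *)
Definition ract (D : preadditive) (M : rmodule D) (X Y : D) (x : hom X Y) :
  {additive M Y -> M X} := @mact (op D) M Y X x.

Lemma ractM (D : preadditive) (M : rmodule D) (X Y Z : D)
    (g : hom Y Z) (f : hom X Y) m :
  ract M (comp g f) m = ract M f (ract M g m).
Proof. exact: (@mactM (op D) M Z Y X f g m). Qed.

Lemma ract1 (D : preadditive) (M : rmodule D) (X : D) m :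
  ract M (idc X) m = m.
Proof. exact: (@mact1 (op D) M X m). Qed.

Lemma mactB (D : preadditive) (N : lmodule D) (X Y : D) (f g : hom X Y) n :
  mact N (f - g) n = mact N f n - mact N g n.
Proof. by apply/eqP; rewrite eq_sym subr_eq -mactD subrK. Qed.

Lemma mact0 (D : preadditive) (N : lmodule D) (X Y : D) n :
  mact N (0 : hom X Y) n = 0.
Proof. by apply: (addIr (mact N 0 n)); rewrite -mactD !add0r. Qed.

(** [N] is the cokernel of [hom X1 - -> hom X0 -], the map given by [d], and [a] is
    the image of the identity of [X0]. *)
Definition presents (D : preadditive) (N : lmodule D) (X0 X1 : D)
    (d : hom X0 X1) (a : N X0) :=
  (forall Y (n : N Y), exists f : hom X0 Y, mact N f a = n) /\
  (forall Y (f : hom X0 Y),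
    mact N f a = 0 <-> exists g : hom X1 Y, comp g d = f).

Section Presentation.
Variables (D : preadditive) (N : lmodule D) (X0 X1 : D).
Variables (d : hom X0 X1) (a : N X0) (da : presents d a).

Definition coef Y (n : N Y) : hom X0 Y := sval (cid (da.1 Y n)).

Lemma coefK Y (n : N Y) : mact N (coef n) a = n.
Proof. exact: (svalP (cid (da.1 Y n))). Qed.

Lemma coef_unique Y (f g : hom X0 Y) : mact N f a = mact N g a ->
  exists h : hom X1 Y, comp h d = f - g.
Proof. by move=> fg; apply/(da.2 Y); rewrite mactB fg subrr. Qed.

End Presentation.

Section TensorElements.
Variables (D : preadditive) (S : skeleton D).

Lemma rep_iso_sig (X : D) :
  {i & {p : hom X (S i) * hom (S i) X | comp p.2 p.1 = idc X}}.
Proof.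
have [i iP] := cid (rep_iso S X); exists i.
have [f fP] := cid iP; have [g [gf _]] := cid fP; by exists (f, g).
Qed.

Definition to_rep (X : D) := (sval (tagged (rep_iso_sig X))).1.
Definition of_rep (X : D) := (sval (tagged (rep_iso_sig X))).2.

Lemma of_to_rep X : comp (of_rep X) (to_rep X) = idc X.
Proof. exact: (svalP (tagged (rep_iso_sig X))). Qed.

Variables (M : rmodule D) (N : lmodule D).

(** The elements [m (x) n] over any object [X], while [tgen] only allows the
    representatives [S i]; an isomorphism to a representative transports them. *)
Definition tens (X : D) (m : M X) (n : N X) : tensor S M N :=
  @tgen D S M N _ (ract M (of_rep X) m) (mact N (to_rep X) n).

Lemma tensDl (X : D) (n : N X) : {morph (fun m : M X => tens m n) : m m' / m + m'}.
Proof. by move=> m m'; rewrite /tens raddfD tgenDl. Qed.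

Lemma tensDr (X : D) (m : M X) : {morph (fun n : N X => tens m n) : n n' / n + n'}.
Proof. by move=> n n'; rewrite /tens raddfD tgenDr. Qed.

Definition tensl (X : D) (m : M X) : {additive N X -> tensor S M N} :=
  mk_additive (tensDr m).

Definition tensr (X : D) (n : N X) : {additive M X -> tensor S M N} :=
  mk_additive (tensDl n).

Lemma tens_balanced (X Y : D) (x : hom X Y) (m : M Y) (n : N X) :
  tens (ract M x m) n = tens m (mact N x n).
Proof.
pose z := comp (to_rep Y) (comp x (of_rep X)).
have zm : ract M (of_rep X) (ract M x m) = ract M z (ract M (of_rep Y) m).
  by rewrite -!ractM /z compA of_to_rep comp1c.
rewrite /tens zm; apply: etrans (tgenA _ _ _) _.
by rewrite -!mactM /z -!compA of_to_rep compc1.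
Qed.

Lemma tens_rep i (m : M (S i)) (n : N (S i)) :
  tens m n = @tgen D S M N i m n.
Proof.
by apply: etrans (tgenA _ _ _) _; rewrite -mactM of_to_rep mact1.
Qed.

Lemma tens_act_eq0 (X Y : D) (x : hom X Y) (m : M Y) (n : N X) :
  ract M x m = 0 -> tens m (mact N x n) = 0.
Proof. by move=> xm; rewrite -tens_balanced xm; exact: (raddf0 (tensr n)). Qed.

Section PresentedRightModule.
Variables (X0 X1 : D) (d : hom X1 X0) (b : M X0).
Hypothesis db : @presents (op D) M X0 X1 d b.

Lemma tensl_surj w : exists n, tensl b n = w.
Proof.
elim/tensor_ind: w => [i m n||_ _ [n <-] [n' <-]].
- have [f <-] := db.1 _ m; exists (mact N (f : @hom D (S i) X0) n).
  by rewrite /= -tens_balanced; exact: tens_rep.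
- by exists 0; rewrite raddf0.
- by exists (n - n'); rewrite raddfB.
Qed.

(** Right exactness: [M] is the cokernel of [hom - X1 -> hom - X0], so [M (x) N]
    is that of [N X1 -> N X0].  The inverse map sends [m (x) p], with [m = b f],
    to the class of [f p]; another choice of [f] differs by a multiple of [d],
    which changes [f p] within the image of [N X1]. *)
Lemma tensl_eq0 n : tensl b n = 0 <-> exists n', mact N d n' = n.
Proof.
split=> [bn|[n' <-]]; last first.
  apply: tens_act_eq0; apply/(db.2 X1); exists (idc X1); exact: (@compc1 D X1 X0 d).
pose c Y (m : M Y) : @hom D Y X0 := coef db m.
pose F i (m : M (S i)) (p : N (S i)) := coker_proj (mact N d) (mact N (c _ m) p).
have FE i (f : @hom D (S i) X0) p : F i (ract M f b) p =
    coker_proj (mact N d) (mact N f p).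
  have [h hE] := coef_unique db (coefK db (ract M f b)).
  apply/eqP; rewrite -subr_eq0 -raddfB -mactB; apply/eqP/coker_proj_eq0.
  by exists (mact N (h : @hom D (S i) X1) p); rewrite -mactM; congr (mact N _ p).
have FDl i m m' p : F i (m + m') p = F i m p + F i m' p.
  rewrite -[m in LHS](coefK db) -[m' in LHS](coefK db) -mactD FE.
  by rewrite mactD raddfD.
have FDr i m p p' : F i m (p + p') = F i m p + F i m p'.
  by rewrite /F !raddfD.
have FA i j (x : @hom D (S i) (S j)) m p :
    F i (@mact _ M (S j) (S i) x m) p = F j m (mact N x p).
  by rewrite -[m in LHS](coefK db) -mactM FE /F -mactM.
apply/coker_proj_eq0; have := congr1 (tensor_lift FDl FDr FA) bn.
rewrite raddf0 => <-; apply: etrans _ (esym (tensor_liftE _ _ _ _ _)).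
by rewrite FE -mactM of_to_rep mact1.
Qed.

End PresentedRightModule.

Section PresentedLeftModule.
Variables (X0 X1 : D) (d : hom X0 X1) (a : N X0).
Hypothesis da : presents d a.

Lemma tensr_surj w : exists m, tensr a m = w.
Proof.
elim/tensor_ind: w => [i m n||_ _ [n <-] [n' <-]].
- have [f <-] := da.1 _ n; exists (ract M f m).
  by rewrite /= tens_balanced; exact: tens_rep.
- by exists 0; rewrite raddf0.
- by exists (n - n'); rewrite raddfB.
Qed.

(** The mirror image of [tensl_eq0]: here [N] is presented and [M] arbitrary. *)
Lemma tensr_eq0 m : tensr a m = 0 <-> exists m', ract M d m' = m.
Proof.
split=> [am|[m' <-]]; last first.
  rewrite /= tens_balanced (_ : mact N d a = 0); first exact: raddf0 (tensl m').
  by apply/(da.2 X1); exists (idc X1); exact: comp1c.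
pose F i (p : M (S i)) (n : N (S i)) :=
  coker_proj (ract M d) (ract M (coef da n) p).
have FE i (f : hom X0 (S i)) p : F i p (mact N f a) =
    coker_proj (ract M d) (ract M f p).
  have [h hE] := coef_unique da (coefK da (mact N f a)).
  apply/eqP; rewrite -subr_eq0 -raddfB.
  rewrite [ract M _ p - _](esym (mactB _ _ _)); apply/eqP/coker_proj_eq0.
  by exists (ract M h p); rewrite -ractM hE.
have FDl i p p' n : F i (p + p') n = F i p n + F i p' n.
  by rewrite /F !raddfD.
have FDr i p n n' : F i p (n + n') = F i p n + F i p n'.
  rewrite -[n in LHS](coefK da) -[n' in LHS](coefK da) -mactD FE.
  by rewrite -raddfD; congr (coker_proj _ _); exact: (@mactD (op D)).
have FA i j (x : @hom D (S i) (S j)) p n :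
    F i (@mact _ M (S j) (S i) x p) n = F j p (mact N x n).
  by rewrite -[n in RHS](coefK da) -mactM FE ractM.
apply/coker_proj_eq0; have := congr1 (tensor_lift FDl FDr FA) am.
rewrite raddf0 => <-; apply: etrans _ (esym (tensor_liftE _ _ _ _ _)).
by rewrite FE -ractM of_to_rep ract1.
Qed.

End PresentedLeftModule.
End TensorElements.

Lemma tensor_map_tens (D : preadditive) (S : skeleton D) (M M' : rmodule D)
    (f : mhom M M') (N : lmodule D) X (m : M X) (n : N X) :
  tensor_map S f N (tens S m n) = tens S (f X m) n.
Proof. by rewrite /tens tensor_mapE /ract mnat. Qed.

Lemma can_tens (C : preadditive) (P : C -> Prop) (S : skeleton (full P))
    (A B : C) (X : full P) (g : hom (sval X) B) (f : hom A (sval X)) :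
  can S A B (@tens _ S (homR P B) (homL P A) X g f) = comp g f.
Proof.
pose i := tag (rep_iso_sig S X).
pose p : hom (sval X) (sval (S i)) := to_rep S X.
pose q : hom (sval (S i)) (sval X) := of_rep S X.
have qp : comp q p = idc (sval X) := of_to_rep S X.
transitivity (comp (comp g q) (comp p f)); first exact: canE.
by rewrite -compA [comp q _]compA qp comp1c.
Qed.

(** * Flatness of free modules *)

Section FreeExact.
Variables (D : preadditive) (S : skeleton D) (M : lmodule D).

Definition fincl (Y : D) (k : fkey S M) :
    {additive hom (S (tag k)) Y -> free_ob S M Y} :=
  mk_additive (@fgenD D S M Y k).

(** Generators over [k'] are sent to 0 when [k' != k]; [tagged_as] handles the cast
    when [k' = k]. *)
Definition fproj_gen (Y : D) (k k' : fkey S M) (f : hom (S (tag k')) Y) :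
    hom (S (tag k)) Y :=
  tagged_as (@fsymb D S M Y k 0) (fsymb f).

Lemma fproj_genE Y k f : @fproj_gen Y k k f = f.
Proof.
exact: (@tagged_asE _ (fun k : fkey S M => hom (S (tag k)) Y : Type)
  (@fsymb D S M Y k 0) f).
Qed.

Lemma fproj_gen0 Y k k' f : k != k' -> @fproj_gen Y k k' f = 0.
Proof. by move=> /eqP kk'; rewrite /fproj_gen /tagged_as; case: eqP. Qed.

Lemma fproj_genD Y k k' : {morph @fproj_gen Y k k' : f g / f + g}.
Proof.
move=> f g; have [e|kk'] := eqVneq k k'; last by rewrite !fproj_gen0 ?addr0.
by case: k' / e f g => f g; rewrite !fproj_genE.
Qed.

Definition fproj (Y : D) (k : fkey S M) :
    {additive free_ob S M Y -> hom (S (tag k)) Y} :=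
  free_lift (@fproj_genD Y k).

Lemma fprojE Y k k' f : fproj Y k (@fgen D S M Y k' f) = fproj_gen k f.
Proof. exact: free_liftE. Qed.

Lemma fproj_nat (X Y : D) (x : hom X Y) k (w : free S M X) :
  fproj Y k (mact (free S M) x w) = comp x (fproj X k w).
Proof.
have := @free_ext D S M X _ (fproj Y k \o mact (free S M) x)
  (postcomp _ x \o fproj X k); apply=> k' f.
change (fproj Y k (free_act S M x (fgen f)) = comp x (fproj X k (fgen f))).
rewrite free_actE !fprojE; have [e|kk'] := eqVneq k k'.
  by case: k' / e f => f; rewrite !fproj_genE.
by rewrite !fproj_gen0 // compc0.
Qed.

Lemma fincl_nat (X Y : D) (x : hom X Y) k (f : hom (S (tag k)) X) :
  mact (free S M) x (fincl X k f) = fincl Y k (comp x f).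
Proof. exact: free_actE. Qed.

(** [free] is a direct sum of representable modules: an element is the sum of its
    finitely many nonzero components. *)
Lemma free_decomposition (Y : D) (w : free S M Y) :
  exists2 s : seq (fkey S M), uniq s & w = \sum_(k <- s) fincl Y k (fproj Y k w).
Proof.
(* Quantifying over all larger supports lets two supports be merged. *)
suff [s sP] : exists s : seq (fkey S M), forall s', uniq s' ->
    {subset s <= s'} -> w = \sum_(k <- s') fincl Y k (fproj Y k w).
  exists (undup s); first exact: undup_uniq.
  by apply: sP => [|k]; rewrite ?undup_uniq ?mem_undup.
elim/pres_ind: w => [[k f]||x y [s sP] [t tP]].
- rewrite -[pgen _ _]/(@fgen D S M Y k f); exists [:: k] => s' us ks.
  have ks' : k \in s' by rewrite ks ?mem_head.
  rewrite (bigD1_seq k) // fprojE fproj_genE big1 => [|k' k'k].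
    by rewrite [RHS]addr0.
  by rewrite fprojE fproj_gen0 // raddf0.
- by exists [::] => s' _ _; rewrite big1 // => k _; rewrite !raddf0.
- exists (s ++ t) => s' us st.
  have ss' : {subset s <= s'} by move=> k ks; rewrite st // mem_cat ks.
  have ts' : {subset t <= s'} by move=> k kt; rewrite st // mem_cat kt orbT.
  rewrite {1}(sP _ us ss') {1}(tP _ us ts') -sumrB; apply: eq_bigr => k _.
  by rewrite !raddfB.
Qed.

(** This is the flatness of [free], in the form of the exactness of its values on
    [X -> Y -> Z]: the representable summands have this exactness by hypothesis,
    and so has their direct sum. *)
Lemma free_exact (X Y Z : D) (x : hom X Y) (y : hom Y Z) :
    (forall i (f : hom (S i) Y), comp y f = 0 -> exists g, comp x g = f) ->
  forall w : free S M Y, mact (free S M) y w = 0 ->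
    exists v, mact (free S M) x v = w.
Proof.
move=> xy w yw.
have ex k : exists g, comp x g = fproj Y k w.
  by apply: xy; rewrite -fproj_nat yw raddf0.
have [s _ ->] := free_decomposition w.
exists (\sum_(k <- s) fincl X k (sval (cid (ex k)))); rewrite raddf_sum.
by apply: eq_bigr => k _; rewrite fincl_nat; case: cid => g /= ->.
Qed.

End FreeExact.

(** * Resolutions by objects of the subcategory *)

Lemma additive_bij (U V : zmodType) (f : {additive U -> V}) :
  (forall x, f x = 0 -> x = 0) -> (forall y, exists x, f x = y) -> bijective f.
Proof.
move=> f0 /choice[g gK]; exists g => // x; apply/eqP; rewrite -subr_eq0.
by apply/eqP/f0; rewrite raddfB gK subrr.
Qed.

Section Resolution.
Variables (C : preadditive) (P : C -> Prop) (B : C) (K : resolution P B).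

Lemma resolution_surj X (PX : P X) (f : hom X B) :
  exists g, comp (cdiff K 0) g = f.
Proof.
have := res_acyclic PX (piq (boundaryp (n := 0) : zmodClosed _)
  (@SubG _ (cyclep (n := 0) : zmodClosed (hom_complex X K 0)) f isT)).
by move=> /eqP; rewrite piq_eq0 => /asboolP.
Qed.

Lemma resolution_exact X (PX : P X) n (f : hom X (augmented B (cterm K) n.+1)) :
  comp (cdiff K n) f = 0 <-> exists g, comp (cdiff K n.+1) g = f.
Proof.
split=> [df|[g <-]]; last by rewrite compA cdiffK comp0c.
exact/(hclass_eq0 (K := hom_complex X K) df)/(res_acyclic PX).
Qed.

Definition res_ob n : full P := exist _ (cterm K n) (res_term K n).

Definition res_map n : @hom (full P) (res_ob n.+1) (res_ob n) := cdiff K n.+1.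

Definition res_aug : homR P B (res_ob 0) := cdiff K 0.

Lemma resolution_presents :
  @presents (op (full P)) (homR P B) (res_ob 0) (res_ob 1) (res_map 0) res_aug.
Proof.
split=> [Y n|Y f]; first exact: (resolution_surj (svalP Y) n).
exact: (@resolution_exact (sval Y) (svalP Y) 0 f).
Qed.

End Resolution.

Section Representable.
Variables (C : preadditive) (P : C -> Prop).

Lemma homR_map_nat (X Y : C) (x : hom X Y) (V W : op (full P)) (v : hom V W)
    (m : homR P X V) :
  postcomp (sval W) x (mact (homR P X) v m) =
  mact (homR P Y) v (postcomp (sval V) x m).
Proof. exact: compA. Qed.

Definition homR_map (X Y : C) (x : hom X Y) : mhom (homR P X) (homR P Y) :=
  @MHom (op (full P)) (homR P X) (homR P Y) (fun V => postcomp (sval V) x)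
    (homR_map_nat x).

Lemma homR_projective (X : full P) : projective (homR P (sval X)).
Proof.
move=> M N e g es; have [m em] := es X (g X (idc X)).
have mD V : {morph (fun x : hom V X => ract M x m) : x y / x + y}.
  by move=> x y; exact: (@mactD (op (full P))).
have mn (V W : op (full P)) (v : hom V W) (x : homR P (sval X) V) :
    mk_additive (mD W) (mact (homR P (sval X)) v x) =
    mact M v (mk_additive (mD V) x) by exact: ractM.
exists (@MHom (op (full P)) (homR P (sval X)) M (fun V => mk_additive (mD V)) mn).
move=> V x; rewrite /= /ract mnat em -mnat; congr (g V _); exact: comp1c.
Qed.

(** Presenting a representable module with no relations makes the Yoneda
    isomorphism [tensor_yoneda] a case of right exactness. *)
Lemma homR_presents (X : full P) :
  @presents (op (full P)) (homR P (sval X)) X X 0 (idc X).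
Proof.
split=> [Y n|Y f]; first by exists n; exact: comp1c.
split=> [f0|[g <-]]; last first.
  by rewrite [LHS]comp1c; exact: comp0c.
exists 0; rewrite -[f](@comp1c C _ _ f); apply: etrans _ (esym f0).
exact: (@comp0c C).
Qed.

Variables (S : skeleton (full P)) (N : lmodule (full P)) (X : full P).

Lemma tensor_yoneda : bijective (@tensl _ S (homR P (sval X)) N X (idc X)).
Proof.
apply: additive_bij => [n|w].
  move=> /(tensl_eq0 S (homR_presents X))[n' <-].
  exact: mact0.
exact: (tensl_surj (homR_presents X)).
Qed.

End Representable.

Section FromResolution.
Variables (C : preadditive) (P : C -> Prop) (S : skeleton (full P)) (A B : C).
Variable K : resolution P B.

Definition homR_resolution : projective_resolution (homR P B).
Proof.
refine (@ProjRes (op (full P)) (homR P B) (fun n => homR P (cterm K n))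
  (fun n => homR_map P (cdiff K n.+1)) (homR_map P (cdiff K 0)) _ _ _ _).
- by move=> n; exact: (@homR_projective C P (res_ob K n)).
- by move=> X n; exact: (resolution_surj K (svalP X)).
- by move=> X p; exact: (@resolution_exact _ _ _ K (sval X) (svalP X) 0).
- by move=> n X p; exact: (@resolution_exact _ _ _ K (sval X) (svalP X) n.+1).
Defined.

Lemma Tor_resolution n :
  zmod_iso (homology (hom_complex A K) n.+2)
    (Tor S n.+1 (homR P B) (homL P A)).
Proof.
apply: zmod_iso_trans (homology_shift _ _) _.
apply: zmod_iso_trans _ (homology_tensor_resolution S (homL P A)
  homR_resolution (std_resolution (op_skeleton S) (homR P B)) n).
apply: (@homology_iso (shift (hom_complex A K))
  (tensor_complex S homR_resolution (homL P A)) n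
  (fun n => @tensl _ S (homR P (cterm K n)) (homL P A) (res_ob K n)
     (idc (res_ob K n)))) => [k|k x].
  exact: (tensor_yoneda S (homL P A) (res_ob K k)).
pose Q := homR P (sval (res_ob K k)); pose N := homL P A.
pose u : Q (res_ob K k) := idc (res_ob K k).
transitivity (@tens _ S Q N (res_ob K k.+1) (ract Q (res_map K k) u) x).
  apply: etrans (tensor_map_tens _ _ _ _) _.
  congr (tens _ _ _); exact: etrans (compc1 _) (esym (comp1c _)).
exact: (@tens_balanced _ S Q N _ _ (res_map K k) u x).
Qed.

Lemma kernel_can_resolution :
  zmod_iso (homology (hom_complex A K) 1) (kernel (can S A B)).
Proof.
apply: (@homology1_kernel (hom_complex A K) _
  (@tensl _ S (homR P B) (homL P A) (res_ob K 0) (res_aug K))).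
- exact: (tensl_surj (resolution_presents K)).
- move=> x; exact: (tensl_eq0 S (N := homL P A) (resolution_presents K)
    (x : homL P A (res_ob K 0))).
- by move=> x; exact: can_tens.
Qed.

End FromResolution.

Section FromCoresolution.
Variables (C : preadditive) (P : C -> Prop) (S : skeleton (full P)) (A B : C).
Variable K : coresolution P A.

Definition cores_ob n : full P := res_ob K n.
Definition cores_map n : @hom (full P) (cores_ob n) (cores_ob n.+1) :=
  res_map K n.
Definition cores_aug : homL P A (cores_ob 0) := res_aug K.

Lemma coresolution_presents : presents (cores_map 0) cores_aug.
Proof.
split=> [Y n|Y f]; first exact: (resolution_surj K (svalP Y) n).
exact: (@resolution_exact _ _ _ K (sval Y) (svalP Y) 0 f).
Qed.

Let R := std_resolution (op_skeleton S) (homR P B).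

(** The modules [pr R j] are contravariant on [full P], so they turn the maps of
    the coresolution around, into maps that lower the degree [i]. *)
Definition coresolution_bicomplex : double_complex :=
  @DoubleComplex (fun i j => pr R j (cores_ob i))
    (fun i j => ract (pr R j) (cores_map i))
    (fun i j => pr_diff R j (cores_ob i))
    (fun i j x =>
      esym (mnat (pr_diff R j) (cores_map i : @hom (op (full P)) _ _) x)).

Definition bicomplex_hom :
  row_resolution coresolution_bicomplex (shift (@hom_complex (op C) B A K)).
Proof.
refine (@RowResolution coresolution_bicomplex (shift (@hom_complex (op C) B A K))
  (fun i => pr_aug R (cores_ob i)) _ _ _ _).
- by move=> i x; exact: (mnat (pr_aug R) (cores_map i : @hom (op (full P)) _ _) x).
- by move=> i u; exact: pr_surj.
- by move=> i x; exact: (@pr_exact0 _ _ R (cores_ob i) x).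
- by move=> i j x; exact: (@pr_exact _ _ R j (cores_ob i) x).
Defined.

Definition bicomplex_tensor :
  row_resolution (transpose coresolution_bicomplex)
    (tensor_complex S R (homL P A)).
Proof.
refine (@RowResolution (transpose coresolution_bicomplex)
  (tensor_complex S R (homL P A))
  (fun i => @tensr _ S (pr R i) (homL P A) (cores_ob 0) cores_aug) _ _ _ _).
- by move=> i x; exact/esym/tensor_map_tens.
- by move=> i u; exact: (tensr_surj coresolution_presents).
- by move=> i x; exact: (tensr_eq0 S coresolution_presents).
- move=> i j x; split=> [dx|[y <-]].
    apply: (@free_exact (op (full P)) (op_skeleton S) (syzygy _ _ i)
      (cores_ob j.+2) (cores_ob j.+1) (cores_ob j) (cores_map j.+1)
      (cores_map j) _ _ dx) => k f.
    by move=> /(@resolution_exact (op C) P A K _ (svalP (S k)) j.+1 f).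
  have dd : comp (cores_map j.+1) (cores_map j) = 0 := cdiffK K j.+1.
  apply: etrans (esym (ractM _ _ _)) _; rewrite dd.
  exact: (@mact0 (op (full P))).
Defined.

Lemma Tor_coresolution n :
  zmod_iso (homology (@hom_complex (op C) B A K) n.+2)
    (Tor S n.+1 (homR P B) (homL P A)).
Proof.
apply: zmod_iso_trans (homology_shift _ _) _.
exact: acyclic_assembly bicomplex_hom bicomplex_tensor n.
Qed.

Lemma kernel_can_coresolution :
  zmod_iso (homology (@hom_complex (op C) B A K) 1) (kernel (can S A B)).
Proof.
apply: (@homology1_kernel (@hom_complex (op C) B A K) _
  (@tensr _ S (homR P B) (homL P A) (cores_ob 0) cores_aug)).
- exact: (tensr_surj coresolution_presents).
- move=> x; exact: (tensr_eq0 S (M := homR P B) coresolution_presents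
    (x : homR P B (cores_ob 0))).
- by move=> x; exact: (@can_tens C P S A B (cores_ob 0) x cores_aug).
Qed.

End FromCoresolution.

Theorem proposition2p2 (C : preadditive) (C_additive : is_additive C)
    (P : C -> Prop) (P_additive : is_additive (full P))
    (S : skeleton (full P)) (A B : C)
    (K : (resolution P B + coresolution P A)%type) :
  (forall n : nat, (2 <= n)%N ->
     zmod_iso (lower_ext K n) (Tor S (n - 1)%N (homR P B) (homL P A))) /\
  zmod_iso (lower_ext K 1%N) (kernel (can S A B)).
Proof.
case: K => K; split.
- by case=> [|[|n]] // _; rewrite subn1; exact: Tor_resolution.
- exact: kernel_can_resolution.
- by case=> [|[|n]] // _; rewrite subn1; exact: Tor_coresolution.
- exact: kernel_can_coresolution.
Qed.
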